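(* Let $d>k\geq1$, $\varepsilon\in(0,1)$, let $A\in\mathbb{R}^{d\times d}$ be symmetric positive semidefinite with $\lambda_k>\lambda_{k+1}$, and let $X_0\in\mathrm{St}(d,k)$ with $\cos\theta_k(U_k,X_0)>0$. Let $\beta>0$ satisfy $\lambda_{k+1}>2\sqrt\beta$. Consider the ANPM iterates $(X_t)_{t\geq0}$ with momentum $\beta$ and perturbations $(\Xi_t)_{t\geq 0}$ satisfying, for all $t\geq0$, $$\|U_{-k}^\top\Xi_t\|_2\leq c(\lambda_k-\lambda_{k+1})\varepsilon,\qquad \|U_k^\top\Xi_t\|_2\leq c(\lambda_k-\lambda_{k+1})\cos\theta_k(U_k,X_t),$$ with $c=1/32$. Then there is $T=O\!\left(\frac{\lambda_k^+}{\lambda_k^+-\lambda_{k+1}^+}\log\frac{\tan\theta_k(U_k,X_0)}{\varepsilon}\right)$ (with an absolute implied constant) such that $\sin\theta_k(U_k,X_t)\leq\varepsilon$ for all $t\geq T$.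
   Context: $A$ has eigenvalues $\lambda_1\geq\dots\geq\lambda_d\geq0$ with orthonormal eigenvectors $u_1,\dots,u_d$; $U_k:=[u_1,\dots,u_k]$, $U_{-k}:=[u_{k+1},\dots,u_d]$. For $x\geq 2\sqrt\beta$, $x^+:=\frac{x+\sqrt{x^2-4\beta}}{2}$. $\mathrm{St}(d,k):=\{X\in\mathbb{R}^{d\times k}:X^\top X=I_k\}$. $\mathrm{QR}(Y)=(X,R)$ with $Y=XR$, $X\in\mathrm{St}(d,k)$, $R$ upper triangular with nonnegative diagonal. $\theta_k(U,X):=\arccos\sigma_{\min}(U^\top X)$. ANPM: given $X_0$, $(X_1,R_1)=\mathrm{QR}(\tfrac12AX_0+\Xi_0)$, and for $t\geq1$, $Y_{t+1}=AX_t-\beta X_{t-1}R_t^{-1}+\Xi_t$, $(X_{t+1},R_{t+1})=\mathrm{QR}(Y_{t+1})$.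
   Formalization: The factor log(tan θ_k(U_k,X_0)/ε) in the bound on T is replaced by 1 + max(0, log(tan θ_k(U_k,X_0)/ε)), since the stated bound is negative or undefined when tan θ_k(U_k,X_0) < ε; the R_t are assumed invertible, as the recursion requires. *)

(* Defs.v *)
From mathcomp Require Import all_boot all_order all_algebra.
From mathcomp Require Import all_classical all_reals all_analysis.
Set Implicit Arguments. Unset Strict Implicit. Unset Printing Implicit Defensive.
Import Order.TTheory GRing.Theory Num.Theory.
Local Open Scope ring_scope.
Local Open Scope classical_set_scope.

Section Defs.
Variable R : realType.

Definition vnorm n (v : 'cV[R]_n) : R := Num.sqrt (\sum_(i < n) v i 0 ^+ 2).

Definition opnorm m n (M : 'M[R]_(m, n)) : R :=
  sup [set vnorm (M *m x) | x in [set x : 'cV[R]_n | vnorm x = 1]].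

Definition sigma_min n (M : 'M[R]_n) : R :=
  inf [set vnorm (M *m x) | x in [set x : 'cV[R]_n | vnorm x = 1]].

Definition stiefel d k (X : 'M[R]_(d, k)) : Prop := X^T *m X = 1%:M.

Definition Ufirst d k (U : 'M[R]_d) : 'M[R]_(d, k) :=
  \matrix_(i < d, j < k) U i (insubd i (val j)).
Definition Ulast d k (U : 'M[R]_d) : 'M[R]_(d, d - k) :=
  \matrix_(i < d, j < d - k) U i (insubd i (k + val j)).

Definition theta d k (Uk : 'M[R]_(d, k)) (X : 'M[R]_(d, k)) : R :=
  acos (sigma_min (Uk^T *m X)).

Definition isQR d k (Y X : 'M[R]_(d, k)) (Rm : 'M[R]_k) : Prop :=
  [/\ stiefel X, Y = X *m Rm,
      (forall i j : 'I_k, (j < i)%N -> Rm i j = 0) &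
      (forall i : 'I_k, 0 <= Rm i i)].

Definition xplus (beta x : R) : R := (x + Num.sqrt (x ^+ 2 - 4 * beta)) / 2.

End Defs.

(* Main.v *)
(* Put M_t = R_t ... R_1. For a fixed vector z, b_t = X_t M_t z satisfies
   b_{t+1} = A b_t - beta b_{t-1} + Xi_t M_t z and b_1 = A b_0 / 2 + Xi_0 z, so that in the
   eigenbasis of A every coordinate obeys a forced Chebyshev recurrence. Let
   n_t = |U_k^T b_t|, v_t = |U_{-k}^T b_t| and delta = lambda_k - lambda_{k+1}.
   The noise in the top block is at most delta n_t / 32; hence, with
   x = lambda_k - delta / 32, n_{t+1} >= x n_t - beta n_{t-1}, which forces
   n_{s+m} >= (15/31) (x^+)^m n_s. Duhamel's formula and |T_t|, |U_t| being largest at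
   lambda_{k+1} bound v_t by (lambda_{k+1}^+)^t v_0 plus a convolution of U_t with
   (delta eps / 32) (n_s + v_s). Let y be the midpoint of lambda_{k+1} and x, and
   rho = y^+ / x^+; the generating function of U_t at 1 / y^+ equals
   y^+ / (y - lambda_{k+1}), which cancels delta, and induction gives
   v_t <= ((5/2) rho^t tan theta_0 + eps/14) n_t. Finally 1 - rho is at least
   (lambda_k^+ - lambda_{k+1}^+) / (5 lambda_k^+). *)

Require Import Defs.
From mathcomp Require Import all_boot all_order all_algebra.
From mathcomp Require Import all_classical all_reals all_analysis.
From mathcomp Require Import ring lra zify.
Set Implicit Arguments. Unset Strict Implicit. Unset Printing Implicit Defensive.
Import Order.TTheory GRing.Theory Num.Theory.
Local Open Scope ring_scope.

(** * Euclidean norm, operator norm and least singular value *)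

Lemma vnorm_ge0 {R : realType} n (v : 'cV[R]_n) : 0 <= vnorm v.
Proof. exact: sqrtr_ge0. Qed.

Lemma sqr_vnorm {R : realType} n (v : 'cV[R]_n) :
  vnorm v ^+ 2 = \sum_(i < n) v i 0 ^+ 2.
Proof. by rewrite sqr_sqrtr // sumr_ge0 // => i _; rewrite sqr_ge0. Qed.

Lemma vnorm0 {R : realType} n : vnorm (0 : 'cV[R]_n) = 0.
Proof.
by rewrite /vnorm big1 ?sqrtr0 // => i _; rewrite mxE expr0n.
Qed.

Lemma vnorm_eq0 {R : realType} n (v : 'cV[R]_n) : vnorm v = 0 -> v = 0.
Proof.
move=> v0; apply/colP => i; rewrite mxE; apply/eqP; rewrite -sqrf_eq0.
have /eqP := sqr_vnorm v; rewrite v0 expr0n eq_sym psumr_eq0; last first.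
  by move=> j _; rewrite sqr_ge0.
by move/allP/(_ i (mem_index_enum i)).
Qed.

Lemma vnormZ {R : realType} n (a : R) (v : 'cV[R]_n) :
  vnorm (a *: v) = `|a| * vnorm v.
Proof.
rewrite -sqrtr_sqr /vnorm -sqrtrM ?sqr_ge0 // mulr_sumr.
by under eq_bigr do rewrite mxE exprMn.
Qed.

Lemma le_vnorm {R : realType} n (u v : 'cV[R]_n) :
  (forall i, `|u i 0| <= `|v i 0|) -> vnorm u <= vnorm v.
Proof.
move=> le_uv; apply: ler_wsqrtr; apply: ler_sum => i _.
by rewrite -[u i 0 ^+ 2]real_normK ?num_real // -[v i 0 ^+ 2]real_normK ?num_real //
  lerXn2r ?nnegrE.
Qed.

(** The sum of the squares (|v| u_i - |u| v_i)^2 equals 2 |u| |v| (|u| |v| - <u, v>), so the last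
    factor is nonnegative once both norms are positive. *)
Lemma vnorm_cauchy {R : realType} n (u v : 'cV[R]_n) :
  \sum_(i < n) u i 0 * v i 0 <= vnorm u * vnorm v.
Proof.
have [u0|u0] := eqVneq (vnorm u) 0.
  by rewrite u0 mul0r big1 // => i _; rewrite (vnorm_eq0 u0) mxE mul0r.
have [v0|v0] := eqVneq (vnorm v) 0.
  by rewrite v0 mulr0 big1 // => i _; rewrite (vnorm_eq0 v0) mxE mulr0.
have uv_gt0 : 0 < vnorm u * vnorm v by rewrite mulr_gt0 // lt_def vnorm_ge0 ?u0 ?v0.
have : 0 <= \sum_(i < n) (vnorm v * u i 0 - vnorm u * v i 0) ^+ 2.
  by rewrite sumr_ge0 // => i _; rewrite sqr_ge0.
have -> : \sum_(i < n) (vnorm v * u i 0 - vnorm u * v i 0) ^+ 2 =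
    2 * (vnorm u * vnorm v) * (vnorm u * vnorm v - \sum_(i < n) u i 0 * v i 0).
  have -> : 2 * (vnorm u * vnorm v) * (vnorm u * vnorm v - \sum_(i < n) u i 0 * v i 0)
    = vnorm v ^+ 2 * vnorm u ^+ 2 + vnorm u ^+ 2 * vnorm v ^+ 2
      - 2 * (vnorm u * vnorm v) * \sum_(i < n) u i 0 * v i 0 by ring.
  rewrite {1}(sqr_vnorm u) {2}(sqr_vnorm v) !mulr_sumr -big_split -sumrB.
  by apply: eq_bigr => i _ /=; ring.
by rewrite pmulr_rge0 ?subr_ge0 // mulr_gt0.
Qed.

Lemma vnormD {R : realType} n (u v : 'cV[R]_n) : vnorm (u + v) <= vnorm u + vnorm v.
Proof.
rewrite -(@ler_pXn2r _ 2) ?nnegrE ?addr_ge0 ?vnorm_ge0 // sqrrD !sqr_vnorm.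
have -> : \sum_(i < n) (u + v) i 0 ^+ 2 =
    \sum_(i < n) u i 0 ^+ 2 + (\sum_(i < n) u i 0 * v i 0) *+ 2 + \sum_(i < n) v i 0 ^+ 2.
  rewrite -sumrMnl -!big_split; apply: eq_bigr => i _ /=.
  by rewrite mxE sqrrD.
by rewrite lerD2r lerD2l lerMn2r vnorm_cauchy.
Qed.

Lemma vnormN {R : realType} n (v : 'cV[R]_n) : vnorm (- v) = vnorm v.
Proof. by rewrite -scaleN1r vnormZ normrN1 mul1r. Qed.

Lemma vnorm_sum {R : realType} n m (f : 'I_m -> 'cV[R]_n) :
  vnorm (\sum_(i < m) f i) <= \sum_(i < m) vnorm (f i).
Proof.
elim/big_ind2 : _ => [|x x' y y' hx hy|//]; first by rewrite vnorm0.
by apply: le_trans (vnormD _ _) _; exact: lerD.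
Qed.

Lemma vnorm_isometry {R : realType} m n (M : 'M[R]_(m, n)) (x : 'cV[R]_n) :
  M^T *m M = 1%:M -> vnorm (M *m x) = vnorm x.
Proof.
have vnormE p (v : 'cV[R]_p) : vnorm v = Num.sqrt ((v^T *m v) 0 0).
  by rewrite mxE /vnorm; under [in RHS]eq_bigr do rewrite mxE -expr2.
by move=> MtM; rewrite !vnormE trmx_mul -mulmxA (mulmxA M^T) MtM mul1mx.
Qed.

Lemma normalizeP {R : realType} n (x : 'cV[R]_n) : x != 0 ->
  vnorm ((vnorm x)^-1 *: x) = 1.
Proof.
move=> x0; rewrite vnormZ ger0_norm ?invr_ge0 ?vnorm_ge0 // mulVf //.
by apply: contra_neq x0; exact: vnorm_eq0.
Qed.

Lemma vnorm_le_opnorm {R : realType} m n (M : 'M[R]_(m, n)) (x : 'cV[R]_n) :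
  vnorm (M *m x) <= opnorm M * vnorm x.
Proof.
have [->|x0] := eqVneq x 0; first by rewrite mulmx0 !vnorm0 mulr0.
have nx0 : 0 < vnorm x.
  by rewrite lt_def vnorm_ge0 andbT; apply: contra_neq x0; exact: vnorm_eq0.
rewrite -ler_pdivrMr // mulrC.
have -> : (vnorm x)^-1 * vnorm (M *m x) = vnorm (M *m ((vnorm x)^-1 *: x)).
  by rewrite -scalemxAr vnormZ ger0_norm // invr_ge0 vnorm_ge0.
apply: ub_le_sup; last by exists ((vnorm x)^-1 *: x) => //=; exact: normalizeP.
(* A supremum dominates its set only if the set is bounded above; the entries of a unit vector being
   at most 1 in absolute value, the sum of the column norms is a bound. *)
exists (\sum_(j < n) vnorm (col j M)) => _ [y /= y1 <-].
have -> : M *m y = \sum_(j < n) y j 0 *: col j M.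
  apply/colP => i; rewrite mxE summxE; apply: eq_bigr => j _.
  by rewrite !mxE mulrC.
apply: le_trans (vnorm_sum _) _; apply: ler_sum => j _.
rewrite vnormZ ler_piMl ?vnorm_ge0 // -(@ler_pXn2r _ 2) ?nnegrE //.
rewrite expr1n real_normK ?num_real // -(expr1n _ 2) -y1 sqr_vnorm (bigD1 j) //=.
by rewrite lerDl sumr_ge0 // => i _; rewrite sqr_ge0.
Qed.

Lemma sigma_min_le_vnorm {R : realType} n (M : 'M[R]_n) (x : 'cV[R]_n) :
  sigma_min M * vnorm x <= vnorm (M *m x).
Proof.
have [->|x0] := eqVneq x 0; first by rewrite mulmx0 !vnorm0 mulr0.
have nx0 : 0 < vnorm x.
  by rewrite lt_def vnorm_ge0 andbT; apply: contra_neq x0; exact: vnorm_eq0.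
rewrite -ler_pdivlMr // mulrC.
have -> : (vnorm x)^-1 * vnorm (M *m x) = vnorm (M *m ((vnorm x)^-1 *: x)).
  by rewrite -scalemxAr vnormZ ger0_norm // invr_ge0 vnorm_ge0.
apply: ge_inf; last by exists ((vnorm x)^-1 *: x) => //=; exact: normalizeP.
by exists 0 => _ [y _ <-]; exact: vnorm_ge0.
Qed.

Lemma vnorm_delta {R : realType} n (i : 'I_n) : vnorm (delta_mx i 0 : 'cV[R]_n) = 1.
Proof.
rewrite /vnorm (bigD1 i) //= big1 => [|j ji]; first by rewrite mxE !eqxx addr0 expr1n sqrtr1.
by rewrite mxE (negbTE ji) expr0n.
Qed.

(** For [n = 0] there is no unit vector and [inf] of the empty set is 0; for positive [n] a basis
    vector inhabits the set. *)
Lemma le_sigma_min {R : realType} n (M : 'M[R]_n) (c : R) : (0 < n)%N ->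
  (forall x : 'cV[R]_n, c * vnorm x <= vnorm (M *m x)) -> c <= sigma_min M.
Proof.
move=> n0 cM; apply: lb_le_inf.
  by exists (vnorm (M *m delta_mx (Ordinal n0) 0)), (delta_mx (Ordinal n0) 0) => //=;
    exact: vnorm_delta.
by move=> _ [y /= y1 <-]; have := cM y; rewrite y1 mulr1.
Qed.

Lemma sigma_min_ge0 {R : realType} n (M : 'M[R]_n) : (0 < n)%N -> 0 <= sigma_min M.
Proof. by move=> n0; apply: le_sigma_min => // x; rewrite mul0r vnorm_ge0. Qed.

Lemma sigma_min_le1 {R : realType} n (M : 'M[R]_n) : (0 < n)%N ->
  (forall x : 'cV[R]_n, vnorm (M *m x) <= vnorm x) -> sigma_min M <= 1.
Proof.
move=> n0 M1; have := sigma_min_le_vnorm M (delta_mx (Ordinal n0) 0).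
by move/le_trans/(_ (M1 _)); rewrite vnorm_delta mulr1.
Qed.

(** * Chebyshev recurrences *)

Lemma xplus_gt0 {R : realType} (beta x : R) : 0 < x -> 0 < xplus beta x.
Proof. by move=> x0; rewrite divr_gt0 // ltr_wpDr // sqrtr_ge0. Qed.

Lemma two_sqrt_discr {R : realType} (beta x : R) : 0 < beta ->
  2 * Num.sqrt beta <= x -> 0 < x /\ 0 <= x ^+ 2 - 4 * beta.
Proof.
move=> b0 bx; have sb : 0 < Num.sqrt beta by rewrite sqrtr_gt0.
have := sqr_sqrtr (ltW b0); split; nra.
Qed.

(** The two summands are the roots of p^2 - x p + beta; [beta / xplus beta x] stands for the smaller
    root throughout. *)
Lemma xplus_root {R : realType} (beta x : R) : 0 < beta ->
  2 * Num.sqrt beta <= x -> xplus beta x + beta / xplus beta x = x.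
Proof.
move=> b0 bx; have [x0 D0] := two_sqrt_discr b0 bx.
have p0 := xplus_gt0 beta x0.
suff e : xplus beta x ^+ 2 + beta = x * xplus beta x.
  by apply: (mulIf (lt0r_neq0 p0)); rewrite mulrDl divfK ?lt0r_neq0 // -expr2.
by have := sqr_sqrtr D0; rewrite /xplus => ?; nra.
Qed.

Lemma xplus_le {R : realType} (beta x y : R) : 0 <= x -> x <= y ->
  xplus beta x <= xplus beta y.
Proof.
move=> x0 xy; rewrite ler_pM2r ?invr_gt0 // lerD //.
by apply: ler_wsqrtr; rewrite lerD2r lerXn2r ?nnegrE // (le_trans x0).
Qed.

Lemma xminus_le_xplus {R : realType} (beta x : R) : 0 < beta ->
  2 * Num.sqrt beta <= x -> beta / xplus beta x <= xplus beta x.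
Proof.
move=> b0 bx; have := xplus_root b0 bx.
suff : x <= 2 * xplus beta x by lra.
by rewrite /xplus; have := sqrtr_ge0 (x ^+ 2 - 4 * beta); lra.
Qed.

(** The two kinds of Chebyshev polynomials differ only in the value [c] at index 1. *)
Fixpoint lin_rec {R : realType} (beta c l : R) (n : nat) : R :=
  if n is m.+1 then
    if m is j.+1 then l * lin_rec beta c l m - beta * lin_rec beta c l j else c
  else 1.

(* With [x = 2 sqrt beta cos phi] these are the rescaled Chebyshev polynomials of
   the first and second kind. *)
Definition chebT {R : realType} (beta l : R) := lin_rec beta (l / 2) l.
Definition chebU {R : realType} (beta l : R) := lin_rec beta l l.

Lemma chebTS {R : realType} (beta l : R) n :
  chebT beta l n.+2 = l * chebT beta l n.+1 - beta * chebT beta l n.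
Proof. by []. Qed.

Lemma chebUS {R : realType} (beta l : R) n :
  chebU beta l n.+2 = l * chebU beta l n.+1 - beta * chebU beta l n.
Proof. by []. Qed.

(** Discrete Duhamel formula. The halved first step makes the homogeneous solution of the first
    kind; the impulse [w s] enters at time s + 1 and then evolves by the second kind, whence the
    shift. The induction carries two consecutive times. *)
Lemma forced_recurrence {R : realType} (beta l : R) (y w : nat -> R) :
  y 1%N = l / 2 * y 0%N + w 0%N ->
  (forall t, y t.+2 = l * y t.+1 - beta * y t + w t.+1) ->
  forall t, y t = chebT beta l t * y 0%N
                  + \sum_(s < t) chebU beta l (t - s.+1) * w s.
Proof.
move=> y1 yS t; suff [] : y t = chebT beta l t * y 0%N
      + \sum_(s < t) chebU beta l (t - s.+1) * w s /\
    y t.+1 = chebT beta l t.+1 * y 0%N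
      + \sum_(s < t.+1) chebU beta l (t.+1 - s.+1) * w s by [].
elim: t => [|t [IH1 IH2]].
  rewrite big_ord0 big_ord_recl big_ord0 /chebT /chebU /= y1; split; ring.
split=> //; rewrite yS IH2 {}IH1 chebTS.
rewrite big_ord_recr [in RHS]big_ord_recr [in RHS]big_ord_recr /=.
rewrite !subnn subSnn.
have -> : \sum_(i < t) chebU beta l (t.+2 - i.+1) * w i =
    l * (\sum_(i < t) chebU beta l (t.+1 - i.+1) * w i)
    - beta * (\sum_(i < t) chebU beta l (t - i.+1) * w i).
  rewrite !mulr_sumr -sumrB; apply: eq_bigr => i _.
  have -> : (t.+2 - i.+1 = (t - i.+1).+2)%N by have := ltn_ord i; lia.
  have -> : (t.+1 - i.+1 = (t - i.+1).+1)%N by have := ltn_ord i; lia.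
  by rewrite chebUS; ring.
by rewrite /chebU /=; ring.
Qed.

Lemma chebT_U {R : realType} (beta l : R) n :
  chebT beta l n.+1 = chebU beta l n.+1 - l / 2 * chebU beta l n.
Proof.
suff [] : chebT beta l n.+1 = chebU beta l n.+1 - l / 2 * chebU beta l n /\
    chebT beta l n.+2 = chebU beta l n.+2 - l / 2 * chebU beta l n.+1 by [].
elim: n => [|n [IH1 IH2]]; first by rewrite /chebT /chebU /=; split; field.
by split=> //; rewrite chebTS IH2 IH1 !chebUS; ring.
Qed.

(** One step of the recurrence multiplies this quadratic form by beta. *)
Lemma chebU_cassini {R : realType} (beta l : R) n :
  chebU beta l n.+1 ^+ 2 - l * chebU beta l n.+1 * chebU beta l n
  + beta * chebU beta l n ^+ 2 = beta ^+ n.+1.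
Proof.
elim: n => [|n IH]; first by rewrite /chebU /=; ring.
by rewrite [RHS]exprS -IH chebUS; ring.
Qed.

(** The Cassini identity reads beta^(n+1) = T_{n+1}^2 + (beta - l^2/4) U_n^2, and the last
    coefficient is nonnegative in this range of l. *)
Lemma chebT_small {R : realType} (beta l : R) n : 0 <= beta ->
  `|l| <= 2 * Num.sqrt beta -> `|chebT beta l n| <= Num.sqrt beta ^+ n.
Proof.
move=> b0 lb; case: n => [|n]; first by rewrite /chebT /= normr1.
rewrite -(@ler_pXn2r _ 2) ?nnegrE ?exprn_ge0 ?sqrtr_ge0 //.
rewrite real_normK ?num_real // exprAC sqr_sqrtr // -(chebU_cassini beta l) chebT_U.
rewrite -subr_ge0 [X in 0 <= X](_ : _ = (beta - l ^+ 2 / 4) * chebU beta l n ^+ 2); last by field.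
rewrite mulr_ge0 ?sqr_ge0 // subr_ge0.
have : `|l| ^+ 2 <= (2 * Num.sqrt beta) ^+ 2.
  by rewrite lerXn2r ?nnegrE ?mulr_ge0 ?sqrtr_ge0.
by rewrite real_normK ?num_real // exprMn sqr_sqrtr //; lra.
Qed.

(** In U_{n+1} = T_{n+1} + (l/2) U_n each step contributes one more term of size at most
    sqrt(beta)^(n+1). *)
Lemma chebU_small {R : realType} (beta l : R) n : 0 <= beta ->
  `|l| <= 2 * Num.sqrt beta -> `|chebU beta l n| <= n.+1%:R * Num.sqrt beta ^+ n.
Proof.
move=> b0 lb; have sb := sqrtr_ge0 beta.
elim: n => [|n IH]; first by rewrite /chebU /= normr1; lra.
have -> : chebU beta l n.+1 = chebT beta l n.+1 + l / 2 * chebU beta l n.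
  by rewrite chebT_U; ring.
apply: le_trans (ler_normD _ _) _; rewrite normrM.
have hl : `|l / 2| <= Num.sqrt beta by rewrite normrM [X in _ * X]ger0_norm ?invr_ge0 //; lra.
have := ler_pM (normr_ge0 _) (normr_ge0 _) hl IH.
have := chebT_small n.+1 b0 lb; rewrite exprS -(natr1 n.+1).
lra.
Qed.

(** The bound of [chebU_small] is attained at 2 sqrt(beta), which is the bridge from small l to the
    monotone range in [chebU_le]. *)
Lemma chebU_double {R : realType} (beta : R) n : 0 <= beta ->
  chebU beta (2 * Num.sqrt beta) n = n.+1%:R * Num.sqrt beta ^+ n.
Proof.
move=> b0; have sb := sqr_sqrtr b0.
suff [] : chebU beta (2 * Num.sqrt beta) n = n.+1%:R * Num.sqrt beta ^+ n /\
  chebU beta (2 * Num.sqrt beta) n.+1 = n.+2%:R * Num.sqrt beta ^+ n.+1 by [].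
elim: n => [|n [IH1 IH2]]; first by rewrite /chebU /= expr1 expr0; split; ring.
split=> //; rewrite chebUS IH2 IH1 !exprS -(natr1 n.+2) -(natr1 n.+1) -(natr1 n).
by move: (Num.sqrt beta) sb => s <-; ring.
Qed.

(** With roots p and q = beta / p, U_{n+2} - p U_{n+1} = q (U_{n+1} - p U_n), so the sign of U_1 - p
    U_0 = q persists. *)
Lemma chebU_ratio {R : realType} (beta l : R) n : 0 < beta ->
  2 * Num.sqrt beta <= l ->
  0 < chebU beta l n /\ xplus beta l * chebU beta l n <= chebU beta l n.+1.
Proof.
move=> b0 bl; have [l0 _] := two_sqrt_discr b0 bl.
have p0 := xplus_gt0 beta l0; have pE := xplus_root b0 bl.
set p := xplus beta l in p0 pE *.
have q0 : 0 < beta / p by rewrite divr_gt0.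
have pq : p * (beta / p) = beta by rewrite mulrC divfK ?lt0r_neq0.
elim: n => [|n [IH1 IH2]]; first by rewrite /chebU /=; split; lra.
have U0 : 0 < chebU beta l n.+1 by apply: lt_le_trans IH2; rewrite mulr_gt0.
split=> //; rewrite chebUS -subr_ge0.
move: (chebU beta l n.+1) (chebU beta l n) IH1 IH2 U0 => u v v0 uv u0.
rewrite -{1}pE -{2}pq.
rewrite [X in 0 <= X](_ : _ = beta / p * (u - p * v)); last by ring.
by rewrite mulr_ge0 ?(ltW q0) // subr_ge0.
Qed.

(** The difference of the two sequences obeys the recurrence at l with the nonnegative source (l' -
    l) U_{n+1}(l'), so the argument of [chebU_ratio] survives. *)
Lemma chebU_mono {R : realType} (beta l l' : R) n : 0 < beta ->
  2 * Num.sqrt beta <= l -> l <= l' -> chebU beta l n <= chebU beta l' n.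
Proof.
move=> b0 bl ll'; have [l0 _] := two_sqrt_discr b0 bl.
have p0 := xplus_gt0 beta l0; have pE := xplus_root b0 bl.
set p := xplus beta l in p0 pE *.
have q0 : 0 < beta / p by rewrite divr_gt0.
have pq : p * (beta / p) = beta by rewrite mulrC divfK ?lt0r_neq0.
rewrite -subr_ge0.
suff [] : 0 <= chebU beta l' n - chebU beta l n /\
  p * (chebU beta l' n - chebU beta l n) <= chebU beta l' n.+1 - chebU beta l n.+1 by [].
elim: n => [|n [IH1 IH2]]; first by rewrite /chebU /=; split; lra.
split; first by apply: le_trans IH2; rewrite mulr_ge0 // ltW.
have [U0 _] := chebU_ratio n.+1 b0 (le_trans bl ll').
rewrite !chebUS -subr_ge0.
move: (chebU beta l' n.+1) (chebU beta l' n) (chebU beta l n.+1) (chebU beta l n)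
  IH1 IH2 U0 => u v u' v' vv' uu' u0.
have : 0 <= beta / p * ((u - u') - p * (v - v')) by rewrite mulr_ge0 ?(ltW q0) // subr_ge0.
have : 0 <= (l' - l) * u by rewrite mulr_ge0 ?subr_ge0 // ltW.
move: (beta / p) pE pq => q pE pq.
rewrite -pE -pq; lra.
Qed.

Lemma chebU_le {R : realType} (beta l l' : R) n : 0 < beta ->
  0 <= l <= l' -> 2 * Num.sqrt beta <= l' -> `|chebU beta l n| <= chebU beta l' n.
Proof.
move=> b0 /andP[l0 ll'] bl'; have [bl|lb] := leP (2 * Num.sqrt beta) l.
  have [U0 _] := chebU_ratio n b0 bl.
  by rewrite gtr0_norm //; exact: chebU_mono.
apply: le_trans (chebU_mono n b0 (lexx _) bl').
rewrite chebU_double ?(ltW b0) //; apply: chebU_small; first exact: ltW.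
by rewrite ger0_norm // ltW.
Qed.

(** For l at least 2 sqrt(beta), T_n = (p^n + q^n) / 2 with q at most p; below, T_n is at most
    sqrt(beta)^n, and sqrt(beta) is at most l'^+. *)
Lemma chebT_le {R : realType} (beta l l' : R) n : 0 < beta ->
  0 <= l <= l' -> 2 * Num.sqrt beta <= l' -> `|chebT beta l n| <= xplus beta l' ^+ n.
Proof.
move=> b0 /andP[l0 ll'] bl'; have [bl|lb] := leP (2 * Num.sqrt beta) l.
  have [l0' _] := two_sqrt_discr b0 bl.
  have p0 := xplus_gt0 beta l0'; have pE := xplus_root b0 bl.
  have qp := xminus_le_xplus b0 bl.
  have pl : xplus beta l ^+ n <= xplus beta l' ^+ n.
    by rewrite lerXn2r ?nnegrE ?xplus_le ?(ltW (xplus_gt0 _ _)) // (lt_le_trans l0').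
  apply: le_trans pl; set p := xplus beta l in p0 pE qp *.
  have q0 : 0 < beta / p by rewrite divr_gt0.
  have pq : p * (beta / p) = beta by rewrite mulrC divfK ?lt0r_neq0.
  have -> : chebT beta l n = (p ^+ n + (beta / p) ^+ n) / 2.
    suff [] : chebT beta l n = (p ^+ n + (beta / p) ^+ n) / 2 /\
      chebT beta l n.+1 = (p ^+ n.+1 + (beta / p) ^+ n.+1) / 2 by [].
    move: (beta / p) pE pq => q pE pq.
    elim: n => [|n [IH1 IH2]].
      by rewrite /chebT /= !expr0 !expr1 pE; split=> //; field.
    by split=> //; rewrite chebTS IH1 IH2 !exprS -pE -pq; field.
  have : (beta / p) ^+ n <= p ^+ n by rewrite lerXn2r ?nnegrE // ltW.
  have : 0 <= (beta / p) ^+ n by rewrite exprn_ge0 // ltW.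
  have : 0 <= p ^+ n by rewrite exprn_ge0 // ltW.
  by move=> ? ? ?; rewrite ger0_norm; lra.
apply: le_trans (chebT_small n (ltW b0) _) _; first by rewrite ger0_norm // ltW.
have sb := sqrtr_ge0 beta; have [l'0 _] := two_sqrt_discr b0 bl'.
rewrite lerXn2r ?nnegrE ?(ltW (xplus_gt0 _ _)) //.
by rewrite /xplus; have := sqrtr_ge0 (l' ^+ 2 - 4 * beta); lra.
Qed.

(* The generating function of [chebU beta l] at [1 / nu] is
   [1 / (1 - l / nu + beta / nu ^ 2)]; the partial sums telescope. *)
Lemma chebU_gen {R : realType} (beta l y : R) n : 0 < beta ->
  2 * Num.sqrt beta <= l -> l < y ->
  \sum_(m < n) chebU beta l m / xplus beta y ^+ m.+1 <= (y - l)^-1.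
Proof.
move=> b0 bl ly; have [l0 _] := two_sqrt_discr b0 bl.
have y0 := lt_trans l0 ly; have ny := xplus_gt0 beta y0.
have nE := xplus_root b0 (le_trans bl (ltW ly)).
rewrite -[_^-1]mul1r ler_pdivlMr ?subr_gt0 // mulrC.
(* With U_{n+1} >= l^+ U_n this makes the remainder of the telescoped sum nonnegative. *)
have bnd : beta / xplus beta y <= xplus beta l.
  apply: le_trans (xminus_le_xplus b0 bl).
  by rewrite ler_pM2l // lef_pV2 ?posrE ?xplus_gt0 // xplus_le // ltW.
case: n => [|n]; first by rewrite big_ord0 mulr0.
have [U0 Ur] := chebU_ratio n b0 bl.
set v := xplus beta y in ny nE bnd *.
suff -> : (y - l) * (\sum_(m < n.+1) chebU beta l m / v ^+ m.+1) =
    1 - (chebU beta l n.+1 - beta / v * chebU beta l n) / v ^+ n.+1.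
  rewrite gerBl divr_ge0 ?exprn_ge0 ?(ltW ny) // subr_ge0.
  by apply: le_trans Ur; rewrite ler_pM2r.
have v0 : v != 0 by rewrite lt0r_neq0.
elim: n {U0 Ur} => [|n IH].
  by rewrite big_ord_recr big_ord0 /chebU /= -nE !expr1; field.
rewrite big_ord_recr /= mulrDr IH chebUS -nE !exprS; field.
by rewrite v0 expf_neq0.
Qed.

(** * Decay of the tangent *)

(** A ratio g in [q, p] between consecutive terms is preserved, because (p + q - g) g - p q = (g -
    q)(p - g) is nonnegative. This lets the growth estimate start at any time s. *)
Lemma ger_recurrence_growth {R : realType} (p q c : R) (n : nat -> R) :
  0 <= q -> q <= p -> 0 <= c <= 1 -> (forall t, 0 <= n t) ->
  (q + c * (p - q)) * n 0%N <= n 1%N ->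
  (forall t, (p + q) * n t.+1 - p * q * n t <= n t.+2) ->
  forall s m, c * p ^+ m * n s <= n (s + m)%N.
Proof.
move=> q0 qp /andP[c0 c1] n0 n1 nS s m.
have gP t : (q + c * (p - q)) * n t <= n t.+1.
  elim: t => [//|t IH]; apply: le_trans (nS t).
  set g := q + _ in IH *.
  have qg : q <= g by rewrite /g; nra.
  have gp : g <= p by rewrite /g; nra.
  have : (p + q - g) * (g * n t) <= (p + q - g) * n t.+1.
    by apply: ler_wpM2l => //; lra.
  have : 0 <= (g - q) * (p - g) * n t.
    by rewrite !mulr_ge0 ?subr_ge0.
  lra.
(* Comparison with the exact solution c p^m + (1 - c) q^m; n_{t+1} - q n_t gains at least a factor p
   per step. *)
have [] : c * p ^+ m * n s + (1 - c) * q ^+ m * n s <= n (s + m)%N /\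
    c * (p - q) * p ^+ m * n s <= n (s + m).+1 - q * n (s + m)%N.
  elim: m => [|m [IH1 IH2]].
    by rewrite addn0 !expr0; have := gP s; split; lra.
  rewrite addnS !exprS; split.
    by have := ler_wpM2l q0 IH1; lra.
  have := ler_wpM2l (le_trans q0 qp) IH2; have := nS (s + m)%N; lra.
have : 0 <= (1 - c) * q ^+ m * n s by rewrite !mulr_ge0 ?subr_ge0 ?exprn_ge0.
lra.
Qed.

(** Differences of square roots are compared through their products with the sums, which are
    differences of squares free of beta. *)
Lemma xplus_gap {R : realType} (beta lk l x y : R) : 0 < beta ->
  2 * Num.sqrt beta <= l -> l < lk -> x = lk - 32^-1 * (lk - l) -> y = (x + l) / 2 ->
  xplus beta lk - xplus beta l <= 5 * (xplus beta x - xplus beta y).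
Proof.
move=> b0 bl llk xE yE.
have [l0 Dl] := two_sqrt_discr b0 bl.
have sqrt_diff (u v : R) : l <= v -> v < u ->
    [/\ 0 <= Num.sqrt (v ^+ 2 - 4 * beta),
        Num.sqrt (v ^+ 2 - 4 * beta) <= Num.sqrt (u ^+ 2 - 4 * beta),
        0 < Num.sqrt (u ^+ 2 - 4 * beta) &
        (Num.sqrt (u ^+ 2 - 4 * beta) - Num.sqrt (v ^+ 2 - 4 * beta)) *
        (Num.sqrt (u ^+ 2 - 4 * beta) + Num.sqrt (v ^+ 2 - 4 * beta))
        = (u - v) * (u + v)].
  move=> lv vu; have v2 : l ^+ 2 <= v ^+ 2 by nra.
  have u2 : v ^+ 2 < u ^+ 2 by nra.
  split; rewrite ?sqrtr_ge0 ?sqrtr_gt0 //; try lra.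
    by apply: ler_wsqrtr; lra.
  have := @sqr_sqrtr _ (u ^+ 2 - 4 * beta); have := @sqr_sqrtr _ (v ^+ 2 - 4 * beta).
  by move=> /(_ ltac:(lra)) ? /(_ ltac:(lra)) ?; lra.
have ly : l < y by lra.
have yx : y < x by lra.
have xlk : x < lk by lra.
have [Dl0 _ Dk0 Ekl] := sqrt_diff _ _ (lexx l) llk.
have [Dy0 DyDx Dx0 Exy] := sqrt_diff _ _ (ltW ly) yx.
have [_ DxDk _ _] := sqrt_diff _ _ (ltW (lt_trans ly yx)) xlk.
rewrite /xplus.
move: (Num.sqrt (lk ^+ 2 - 4 * beta)) (Num.sqrt (l ^+ 2 - 4 * beta))
  (Num.sqrt (x ^+ 2 - 4 * beta)) (Num.sqrt (y ^+ 2 - 4 * beta))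
  Dl0 Dk0 Ekl Dy0 DyDx Dx0 Exy DxDk => dk dl dx dy Dl0 Dk0 Ekl Dy0 DyDx Dx0 Exy DxDk.
suff : dk - dl <= 5 * (dx - dy) by lra.
have kl : (dk - dl) * dx <= (lk - l) * (lk + l).
  have kl0 : 0 <= dk - dl.
    by rewrite -(pmulr_lge0 _ (_ : 0 < dk + dl)) ?Ekl ?mulr_ge0; lra.
  rewrite -Ekl ler_wpM2l //; lra.
have xy : (x - y) * (x + y) <= (dx - dy) * (2 * dx).
  rewrite -Exy ler_wpM2l //; lra.
(* Here x + y >= lk + l and 64/31 <= 5/2; bounding dx + dy by 2 dx doubles 5/2 to the final 5. *)
have gap : (lk - l) * (lk + l) <= 5 / 2 * ((x - y) * (x + y)).
  have -> : x - y = 31 / 64 * (lk - l) by lra.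
  have : 0 <= (lk - l) * (x + y - (lk + l)) by rewrite mulr_ge0; lra.
  have : 0 <= (lk - l) * (x + y) by rewrite mulr_ge0; lra.
  lra.
rewrite -(ler_pM2r Dx0); lra.
Qed.

Lemma tangent_decay {R : realType} (beta lk l x y eps h0 : R) (n v : nat -> R) :
  0 < beta -> 2 * Num.sqrt beta <= l -> l < lk ->
  x = lk - 32^-1 * (lk - l) -> y = (x + l) / 2 -> 0 < eps < 1 -> 0 <= h0 ->
  (forall t, 0 <= n t) ->
  (lk / 2 - 32^-1 * (lk - l)) * n 0%N <= n 1%N ->
  (forall t, x * n t.+1 - beta * n t <= n t.+2) ->
  (forall t, v t <= xplus beta l ^+ t * v 0%N
     + \sum_(s < t) chebU beta l (t - s.+1) * (32^-1 * (lk - l) * eps * (n s + v s))) ->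
  v 0%N <= h0 * n 0%N ->
  forall t, v t <= (5 / 2 * (xplus beta y / xplus beta x) ^+ t * h0 + eps / 14) * n t.
Proof.
move=> b0 bl llk xE yE /andP[e0 e1] h00 n0 n1 nS vP v0.
have ly : l < y by lra.
have yx : y < x by lra.
have [l0 Dl] := two_sqrt_discr b0 bl.
have by_ := le_trans bl (ltW ly); have bx := le_trans by_ (ltW yx).
have [x0 Dx] := two_sqrt_discr b0 bx; have [y0 _] := two_sqrt_discr b0 by_.
have mu0 := xplus_gt0 beta x0; have nu0 := xplus_gt0 beta y0.
have muE := xplus_root b0 bx; have qmu := xminus_le_xplus b0 bx.
have a0 := xplus_gt0 beta l0.
have anu : xplus beta l <= xplus beta y by rewrite xplus_le // ltW.
have genx := fun t => chebU_gen t b0 bl (lt_trans ly yx).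
have geny := fun t => chebU_gen t b0 bl ly.
have growth : forall s m, 15 / 31 * xplus beta x ^+ m * n s <= n (s + m)%N.
  have pq : xplus beta x * (beta / xplus beta x) = beta.
    by rewrite mulrC divfK ?lt0r_neq0.
  apply: (@ger_recurrence_growth _ _ (beta / xplus beta x)) => //.
  - by rewrite divr_ge0 // ltW.
  - by lra.
  - apply: le_trans n1; apply: ler_wpM2r => //.
    (* Let D be this square root, the gap between the two roots. The first step asks for (1/2 - c) D
       >= (lk - l) / 64, and D >= x - l makes c = 15/31 just admissible. *)
    have : 31 / 32 * (lk - l) <= Num.sqrt (x ^+ 2 - 4 * beta).
      rewrite -[leLHS]ger0_norm; last by lra.
      rewrite -sqrtr_sqr; apply: ler_wsqrtr.
      have -> : 31 / 32 * (lk - l) = x - l by lra.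
      have : 0 <= l * (x - l) by rewrite mulr_ge0; lra.
      lra.
    have -> : beta / xplus beta x = x - xplus beta x by lra.
    by rewrite /xplus; lra.
  - by move=> t; rewrite muE pq.
move: (xplus beta x) (xplus beta y) mu0 nu0 {muE qmu} anu genx geny growth
  => mu nu mu0 nu0 anu genx geny growth.
have r0 : 0 < nu / mu by rewrite divr_gt0.
have nuE : nu = nu / mu * mu by rewrite divfK ?lt0r_neq0.
move: (nu / mu) r0 nuE => rho r0 nuE.
have U0 m : 0 <= chebU beta l m by have [/ltW] := chebU_ratio m b0 bl.
have d0 : 0 < lk - l by rewrite subr_gt0.
elim/ltn_ind => t IH; apply: le_trans (vP t) _.
have nle s m : (s + m = t)%N -> n s <= 31 / 15 * n t / mu ^+ m.
  by move=> <-; rewrite ler_pdivlMr ?exprn_gt0 //; have := growth s m; lra.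
have K0 : 0 <= 32^-1 * (lk - l) * eps by rewrite !mulr_ge0 // ltW.
have [K KE] : {K | K = 32^-1 * (lk - l) * eps} by eexists.
rewrite -KE in K0 *.
have lead : xplus beta l ^+ t * v 0%N <= rho ^+ t * h0 * (31 / 15 * n t).
  have h1 : xplus beta l ^+ t * v 0%N <= nu ^+ t * (h0 * n 0%N).
    apply: le_trans (_ : xplus beta l ^+ t * (h0 * n 0%N) <= _).
      by rewrite ler_wpM2l // exprn_ge0 // ltW.
    by rewrite ler_wpM2r ?mulr_ge0 // lerXn2r // nnegrE ltW.
  apply: le_trans h1 _; rewrite nuE exprMn.
  have h2 := ler_wpM2l h00 (nle 0%N t (add0n t)).
  have h3 : 0 <= rho ^+ t * mu ^+ t by rewrite mulr_ge0 ?exprn_ge0 // ltW.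
  apply: le_trans (ler_wpM2l h3 h2) _.
  rewrite le_eqVlt; apply/orP; left; apply/eqP; field.
  by rewrite expf_neq0 ?lt0r_neq0.
(* With m = t - s - 1, the stationary part of the induction hypothesis is summed against mu^-(m+1).
   The transient part satisfies rho^s mu^-(m+1) = rho^t nu^-(m+1), so it is summed against nu and
   keeps the full factor rho^t. *)
have noise : \sum_(s < t) chebU beta l (t - s.+1) * (K * (n s + v s)) <=
    31 / 15 * n t * K * ((1 + eps / 14) * (x - l)^-1 + 5 / 2 * h0 * rho ^+ t * (y - l)^-1).
  apply: le_trans (_ : \sum_(m < t) 31 / 15 * n t * K *
      ((1 + eps / 14) * (chebU beta l m / mu ^+ m.+1)
       + 5 / 2 * h0 * rho ^+ t * (chebU beta l m / nu ^+ m.+1)) <= _); last first.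
    rewrite -mulr_sumr big_split /= -!mulr_sumr; apply: ler_wpM2l.
      by apply: mulr_ge0 K0; rewrite !mulr_ge0 ?invr_ge0.
    apply: lerD; [apply: (ler_wpM2l _ (genx t)) | apply: (ler_wpM2l _ (geny t))].
      by lra.
    by rewrite !mulr_ge0 ?invr_ge0 ?exprn_ge0 ?(ltW r0).
  rewrite [leRHS](reindex_inj rev_ord_inj) /=; apply: ler_sum => s _.
  have st : (s + (t - s.+1).+1 = t)%N by rewrite subnSK // subnKC // ltnW.
  move: (IH s (ltn_ord s)) (nle _ _ st) => IHs ns.
  move: (t - s.+1)%N st ns => m st ns.
  have hs : n s + v s <= (1 + eps / 14 + 5 / 2 * h0 * rho ^+ s) * (31 / 15 * n t / mu ^+ m.+1).
    apply: le_trans (_ : (1 + eps / 14 + 5 / 2 * h0 * rho ^+ s) * n s <= _); first by lra.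
    rewrite ler_wpM2l //.
    have : 0 <= h0 * rho ^+ s by rewrite mulr_ge0 ?exprn_ge0 // ltW.
    by lra.
  apply: le_trans (ler_wpM2l (U0 m) (ler_wpM2l K0 hs)) _.
  rewrite nuE exprMn -[in rho ^+ t]st exprD.
  have : mu ^+ m.+1 != 0 by rewrite expf_neq0 ?lt0r_neq0.
  have : rho ^+ m.+1 != 0 by rewrite expf_neq0 ?lt0r_neq0.
  move: (rho ^+ s) (rho ^+ m.+1) (mu ^+ m.+1) => P Q M Q0 M0.
  by rewrite le_eqVlt; apply/orP; left; apply/eqP; field; rewrite ?Q0 ?M0.
apply: le_trans (lerD lead noise) _.
have -> : x - l = 31 / 32 * (lk - l) by lra.
have -> : y - l = 31 / 64 * (lk - l) by lra.
(* The induction closes because 31/15 + 1/3 <= 5/2 and (1 + 1/14) / 15 = 1/14. *)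
have -> : rho ^+ t * h0 * (31 / 15 * n t) + 31 / 15 * n t * K *
    ((1 + eps / 14) * (31 / 32 * (lk - l))^-1
     + 5 / 2 * h0 * rho ^+ t * (31 / 64 * (lk - l))^-1)
   = ((31 / 15 + eps / 3) * (h0 * rho ^+ t) + (eps / 15 + eps * eps / 210)) * n t.
  by rewrite KE; field; rewrite subr_eq0 gt_eqF.
apply: ler_wpM2r => //.
have : 0 <= (1 - eps) * (h0 * rho ^+ t) by rewrite !mulr_ge0 ?exprn_ge0 ?subr_ge0 // ltW.
have : 0 <= eps * (1 - eps) by rewrite mulr_ge0 ?subr_ge0 // ltW.
have : 0 <= h0 * rho ^+ t by rewrite mulr_ge0 ?exprn_ge0 // ltW.
lra.
Qed.

(** From r <= exp(r - 1), (2 + L) / (1 - r) steps bring r^t below exp(-2 - L). Since e^2 >= 3, r^t h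
    is then at most eps / 3, and 5/6 + 1/14 < 1. *)
Lemma geometric_iteration_count {R : realType} (r h eps : R) :
  0 < r < 1 -> 0 < eps < 1 -> 0 <= h ->
  exists T : nat, T%:R <= 3 * (1 - r)^-1 * (1 + Num.max 0 (ln (h / eps))) /\
    forall t, (T <= t)%N -> 5 / 2 * r ^+ t * h + eps / 14 <= eps.
Proof.
move=> /andP[r0 r1] /andP[e0 e1] h0; set L := Num.max 0 _.
have L0 : 0 <= L by rewrite le_max lexx.
have ir : 0 < (1 - r)^-1 by rewrite invr_gt0 subr_gt0.
have ir1 : 1 <= (1 - r)^-1 by rewrite invf_ge1 ?subr_gt0 //; lra.
pose B := (2 + L) * (1 - r)^-1.
have B0 : 0 <= B by rewrite mulr_ge0 ?ltW //; lra.
exists (Num.truncn B).+1; split.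
  have := truncn_le B; rewrite B0 => hB; rewrite -natr1.
  have : 0 <= L * (1 - r)^-1 by rewrite mulr_ge0 // ltW.
  by move: hB; rewrite /B; lra.
move=> t Tt.
have tB : B <= t%:R.
  apply: le_trans (ltW (truncnS_gt B)) _; by rewrite ler_nat.
have rt : r ^+ t <= expR (- (2 + L)).
  have re : r <= expR (- (1 - r)) by have := expR_ge1Dx (- (1 - r)); lra.
  apply: le_trans (_ : expR (- (1 - r)) ^+ t <= _).
    by rewrite lerXn2r ?nnegrE ?expR_ge0 // ltW.
  rewrite -expRM_natl ler_expR -[X in _ * - X]invrK mulrN lerN2.
  by rewrite ler_pdivlMr.
have e2 : 3 <= expR (2 : R) by have := expR_ge1Dx (2 : R); lra.
have he : h <= eps * expR L.
  (* For h = 0 the logarithm does not invert the exponential, but the bound is trivial. *)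
  have [->|hn0] := eqVneq h 0; first by rewrite mulr_ge0 ?expR_ge0 // ltW.
  have hp : 0 < h / eps by rewrite divr_gt0 // lt_def hn0 h0.
  rewrite mulrC -ler_pdivrMr // -[leLHS]lnK ?posrE // ler_expR.
  by rewrite le_max lexx orbT.
have rh : r ^+ t * h <= eps / 3.
  apply: le_trans (ler_pM (exprn_ge0 _ (ltW r0)) h0 rt he) _.
  rewrite opprD expRD mulrCA -mulrA -expRD addNr expR0 mulr1 ler_wpM2l ?(ltW e0) //.
  by rewrite expRN lef_pV2 ?posrE ?expR_gt0.
lra.
Qed.

(** * Eigenspaces and the angle *)

Lemma vnorm_diag_le {R : realType} m (f : 'I_m -> R) (c : R) (u : 'cV[R]_m) :
  (forall i, `|f i| <= c) -> vnorm (\col_i (f i * u i 0)) <= c * vnorm u.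
Proof.
(* The sign of [c] is known only through an index, so the empty case is separate. *)
case: m f u => [|m] f u fc; first by rewrite [vnorm _]/vnorm [vnorm u]/vnorm !big_ord0 sqrtr0 mulr0.
have c0 : 0 <= c by apply: le_trans (fc ord0).
rewrite -[c in leRHS]ger0_norm // -vnormZ; apply: le_vnorm => i.
by rewrite !mxE !normrM ler_wpM2r // (ger0_norm c0).
Qed.

Lemma vnorm_diag_ge {R : realType} m (f : 'I_m -> R) (c : R) (u : 'cV[R]_m) :
  0 <= c -> (forall i, c <= f i) -> c * vnorm u <= vnorm (\col_i (f i * u i 0)).
Proof.
move=> c0 cf; rewrite -[c in leLHS]ger0_norm // -vnormZ; apply: le_vnorm => i.
rewrite !mxE !normrM ler_wpM2r // (ger0_norm c0).
by apply: le_trans (cf i) _; exact: ler_norm.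
Qed.

Lemma diag_forced_recurrence {R : realType} m (beta l : R) (lam : 'I_m -> R)
    (y w : nat -> 'cV[R]_m) :
  0 < beta -> 2 * Num.sqrt beta <= l -> (forall i, 0 <= lam i <= l) ->
  (forall i, y 1%N i 0 = lam i / 2 * y 0%N i 0 + w 0%N i 0) ->
  (forall t i, y t.+2 i 0 = lam i * y t.+1 i 0 - beta * y t i 0 + w t.+1 i 0) ->
  forall t, vnorm (y t) <= xplus beta l ^+ t * vnorm (y 0%N)
    + \sum_(s < t) chebU beta l (t - s.+1) * vnorm (w s).
Proof.
move=> b0 bl laml y1 yS t.
have -> : y t = \col_i (chebT beta (lam i) t * y 0%N i 0)
    + \sum_(s < t) \col_i (chebU beta (lam i) (t - s.+1) * w s i 0).
  apply/colP => i; rewrite mxE summxE mxE.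
  rewrite (@forced_recurrence _ beta (lam i) (fun t => y t i 0) (fun t => w t i 0)) //.
  by congr (_ + _); apply: eq_bigr => s _; rewrite mxE.
apply: le_trans (vnormD _ _) _; apply: lerD.
  by apply: vnorm_diag_le => i; exact: chebT_le.
apply: le_trans (vnorm_sum _) _; apply: ler_sum => s _.
by apply: vnorm_diag_le => i; exact: chebU_le.
Qed.

Section EigenSplit.
Variables (R : realType) (d k : nat) (A U : 'M[R]_d) (lam : nat -> R).
Hypotheses (kd : (k < d)%N) (A_sym : A^T = A) (U_orth : U^T *m U = 1%:M).
Hypothesis A_eig : forall i : 'I_d, A *m col i U = lam i *: col i U.

(** The index [i] witnesses that the column number is in range, so the default of [insubd] is not
    taken. *)
Lemma Ufirst_mulmx (w : 'cV[R]_d) (j : 'I_k) (i : 'I_d) : val i = val j ->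
  ((Ufirst k U)^T *m w) j 0 = (U^T *m w) i 0.
Proof.
move=> ij; rewrite !mxE; apply: eq_bigr => a _; rewrite !mxE.
by rewrite -ij valKd.
Qed.

Lemma Ulast_mulmx (w : 'cV[R]_d) (j : 'I_(d - k)) (i : 'I_d) : val i = (k + val j)%N ->
  ((Ulast k U)^T *m w) j 0 = (U^T *m w) i 0.
Proof.
move=> ij; rewrite !mxE; apply: eq_bigr => a _; rewrite !mxE.
by rewrite -[in RHS](valKd a i) ij.
Qed.

Lemma eigen_mulmx (w : 'cV[R]_d) (i : 'I_d) :
  (U^T *m (A *m w)) i 0 = lam i * (U^T *m w) i 0.
Proof.
have : row i (U^T *m (A *m w)) = lam i *: row i (U^T *m w).
  rewrite mulmxA row_mul row_mul -tr_col -[A in LHS]A_sym -trmx_mul A_eig.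
  by rewrite linearZ /= -scalemxAl tr_col -row_mul.
by move/rowP/(_ 0); rewrite !mxE.
Qed.

Lemma Ufirst_eigen (w : 'cV[R]_d) (j : 'I_k) :
  ((Ufirst k U)^T *m (A *m w)) j 0 = lam j * ((Ufirst k U)^T *m w) j 0.
Proof.
have jd := ltn_trans (ltn_ord j) kd.
by rewrite !(@Ufirst_mulmx _ _ (Ordinal jd)) // eigen_mulmx.
Qed.

Lemma Ulast_eigen (w : 'cV[R]_d) (j : 'I_(d - k)) :
  ((Ulast k U)^T *m (A *m w)) j 0 = lam (k + j)%N * ((Ulast k U)^T *m w) j 0.
Proof.
have jd : (k + j < d)%N by rewrite -ltn_subRL.
by rewrite !(@Ulast_mulmx _ _ (Ordinal jd)) // eigen_mulmx.
Qed.

Lemma vnorm_split (w : 'cV[R]_d) :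
  vnorm w ^+ 2 = vnorm ((Ufirst k U)^T *m w) ^+ 2 + vnorm ((Ulast k U)^T *m w) ^+ 2.
Proof.
have Uw : vnorm (U^T *m w) = vnorm w.
  by apply: vnorm_isometry; rewrite trmxK; exact: mulmx1C.
rewrite -Uw !sqr_vnorm.
pose F n := (U^T *m w) (insubd (Ordinal kd) n) 0 ^+ 2.
have -> : \sum_(i < d) (U^T *m w) i 0 ^+ 2 = \sum_(0 <= i < d) F i.
  by rewrite big_mkord; apply: eq_bigr => i _; rewrite /F valKd.
rewrite (@big_cat_nat _ _ _ k) ?(ltnW kd) //= big_mkord; congr (_ + _).
  apply: eq_bigr => j _; rewrite (@Ufirst_mulmx _ _ (insubd (Ordinal kd) j)) //.
  by rewrite insubdK // unfold_in; exact: ltn_trans (ltn_ord j) kd.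
rewrite -{1}[k]add0n big_addn big_mkord.
apply: eq_bigr => j _; rewrite (@Ulast_mulmx _ _ (insubd (Ordinal kd) (k + j)%N)).
  by rewrite /F addnC.
by rewrite insubdK // unfold_in -ltn_subRL.
Qed.

Section Angle.
Variable X : 'M[R]_(d, k).
Hypotheses (k_gt0 : (0 < k)%N) (X_st : stiefel X).
Let F := (Ufirst k U)^T *m X.
Let L := (Ulast k U)^T *m X.

Lemma vnorm_split_stiefel (x : 'cV[R]_k) :
  vnorm x ^+ 2 = vnorm (F *m x) ^+ 2 + vnorm (L *m x) ^+ 2.
Proof. by rewrite -(vnorm_isometry x X_st) vnorm_split !mulmxA. Qed.

Lemma sigma_min_itv : 0 <= sigma_min F <= 1.
Proof.
rewrite sigma_min_ge0 //= sigma_min_le1 // => x.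
rewrite -(@ler_pXn2r _ 2) ?nnegrE ?vnorm_ge0 // (vnorm_split_stiefel x).
by rewrite lerDl sqr_ge0.
Qed.

Lemma cos_theta : cos (theta (Ufirst k U) X) = sigma_min F.
Proof.
have /andP[s0 s1] := sigma_min_itv.
by rewrite acosK // in_itv /= s1 andbT; apply: le_trans s0; rewrite oppr_le0.
Qed.

Lemma sin_theta : sin (theta (Ufirst k U) X) = Num.sqrt (1 - sigma_min F ^+ 2).
Proof.
have /andP[s0 s1] := sigma_min_itv.
by rewrite sin_acos // s1 andbT; apply: le_trans s0; rewrite oppr_le0.
Qed.

Lemma tan_theta_ge0 : 0 <= tan (theta (Ufirst k U) X).
Proof.
have /andP[s0 _] := sigma_min_itv.
by rewrite /tan sin_theta cos_theta divr_ge0 ?sqrtr_ge0.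
Qed.

(** With s = cos theta, inserting |x|^2 = |Fx|^2 + |Lx|^2 into s^2 |x|^2 <= |Fx|^2 gives s^2 |Lx|^2
    <= (1 - s^2) |Fx|^2. *)
Lemma vnorm_le_tan (x : 'cV[R]_k) : 0 < sigma_min F ->
  vnorm (L *m x) <= tan (theta (Ufirst k U) X) * vnorm (F *m x).
Proof.
move=> s0; have /andP[_ s1] := sigma_min_itv.
rewrite /tan sin_theta cos_theta -(@ler_pXn2r _ 2) ?nnegrE ?mulr_ge0 ?vnorm_ge0
  ?sqrtr_ge0 ?invr_ge0 ?(ltW s0) //.
rewrite !exprMn exprVn (@sqr_sqrtr _ (1 - _)); last by rewrite subr_ge0 exprn_ile1 // ltW.
have sx := sigma_min_le_vnorm F x.
have : (sigma_min F * vnorm x) ^+ 2 <= vnorm (F *m x) ^+ 2.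
  by rewrite lerXn2r ?nnegrE ?mulr_ge0 ?vnorm_ge0 // ltW.
rewrite exprMn (vnorm_split_stiefel x) mulrAC ler_pdivlMr ?exprn_gt0 //.
lra.
Qed.

(** The hypothesis yields (1 - eps^2) |x|^2 <= (1 - eps^4) |Fx|^2, hence cos theta >= sqrt(1 -
    eps^2). *)
Lemma sin_theta_le (eps : R) : 0 <= eps <= 1 ->
  (forall x, vnorm (L *m x) <= eps * vnorm (F *m x)) ->
  sin (theta (Ufirst k U) X) <= eps.
Proof.
move=> /andP[e0 e1] Le; rewrite sin_theta -[eps]ger0_norm // -sqrtr_sqr.
have ee : eps ^+ 2 <= 1 by rewrite exprn_ile1.
apply: ler_wsqrtr; suff : Num.sqrt (1 - eps ^+ 2) <= sigma_min F.
  move=> h; have : Num.sqrt (1 - eps ^+ 2) ^+ 2 <= sigma_min F ^+ 2.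
    by rewrite lerXn2r ?nnegrE ?sqrtr_ge0 // (le_trans (sqrtr_ge0 _) h).
  by rewrite sqr_sqrtr ?subr_ge0 //; lra.
apply: le_sigma_min => // x.
rewrite -(@ler_pXn2r _ 2) ?nnegrE ?mulr_ge0 ?vnorm_ge0 ?sqrtr_ge0 //.
rewrite exprMn (@sqr_sqrtr _ (1 - _)) ?subr_ge0 // (vnorm_split_stiefel x).
have : vnorm (L *m x) ^+ 2 <= (eps * vnorm (F *m x)) ^+ 2.
  by rewrite lerXn2r ?nnegrE ?mulr_ge0 ?vnorm_ge0.
rewrite exprMn => h.
have ee' : 0 <= 1 - eps ^+ 2 by rewrite subr_ge0.
have := ler_wpM2l ee' h.
have : 0 <= (eps ^+ 2 * vnorm (F *m x)) ^+ 2 by rewrite sqr_ge0.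
lra.
Qed.

End Angle.
End EigenSplit.

(** * The iteration *)

(** This is M_t; multiplying X_t by it undoes the QR normalisations. [Rm 0] never enters. *)
Fixpoint rprod {R : realType} k (Rm : nat -> 'M[R]_k) (t : nat) : 'M[R]_k :=
  if t is s.+1 then Rm t *m rprod Rm s else 1%:M.

Lemma rprod_unit {R : realType} k (Rm : nat -> 'M[R]_k) t :
  (forall t, (1 <= t)%N -> Rm t \in unitmx) -> rprod Rm t \in unitmx.
Proof.
by move=> Ru; elim: t => [|t IH]; rewrite ?unitmx1 //= unitmx_mul Ru.
Qed.

Lemma anpm_decay {R : realType} (d k : nat) (A U : 'M[R]_d) (lam : nat -> R)
    (eps beta x y : R) (X : nat -> 'M[R]_(d, k)) (Rm : nat -> 'M[R]_k)
    (Xi : nat -> 'M[R]_(d, k)) :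
  (k < d)%N -> (1 <= k)%N -> 0 < eps < 1 -> A^T = A ->
  (forall i j : nat, (i <= j < d)%N -> lam j <= lam i) ->
  (forall i : nat, (i < d)%N -> 0 <= lam i) ->
  U^T *m U = 1%:M ->
  (forall i : 'I_d, A *m col i U = lam i *: col i U) ->
  lam k < lam k.-1 ->
  (forall t, stiefel (X t)) ->
  0 < cos (theta (Ufirst k U) (X 0%N)) ->
  0 < beta -> 2 * Num.sqrt beta <= lam k ->
  X 1%N *m Rm 1%N = 2^-1 *: (A *m X 0%N) + Xi 0%N ->
  (forall t, (1 <= t)%N -> Rm t \in unitmx) ->
  (forall t, (1 <= t)%N -> X t.+1 *m Rm t.+1 =
     A *m X t - beta *: (X t.-1 *m invmx (Rm t)) + Xi t) ->
  (forall t, opnorm ((Ulast k U)^T *m Xi t) <= 32^-1 * (lam k.-1 - lam k) * eps) ->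
  (forall t, opnorm ((Ufirst k U)^T *m Xi t)
     <= 32^-1 * (lam k.-1 - lam k) * cos (theta (Ufirst k U) (X t))) ->
  x = lam k.-1 - 32^-1 * (lam k.-1 - lam k) -> y = (x + lam k) / 2 ->
  forall t z, vnorm ((Ulast k U)^T *m X t *m z) <=
    (5 / 2 * (xplus beta y / xplus beta x) ^+ t * tan (theta (Ufirst k U) (X 0%N))
     + eps / 14) * vnorm ((Ufirst k U)^T *m X t *m z).
Proof.
move=> kd k0 e01 A_sym lam_mono lam_ge0 U_orth A_eig gap X_st cos0 b0 bl X1 Ru XS
  noiseL noiseF xE yE t z.
set F := (Ufirst k U)^T; set L := (Ulast k U)^T.
have Mu := rprod_unit _ Ru.
have -> : z = rprod Rm t *m (invmx (rprod Rm t) *m z) by rewrite mulKVmx.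
move: (invmx _ *m z) => {}z.
pose w s := rprod Rm s *m z; pose b s := X s *m w s.
have b1 : b 1%N = 2^-1 *: (A *m b 0%N) + Xi 0%N *m w 0%N.
  by rewrite /b /w /= mulmx1 mul1mx mulmxA X1 mulmxDl -scalemxAl !mulmxA.
have bS s : b s.+2 = A *m b s.+1 - beta *: b s + Xi s.+1 *m w s.+1.
  rewrite /b {1}/w [rprod Rm s.+2]/= -mulmxA -/(w s.+1) mulmxA XS //= !mulmxDl mulNmx.
  rewrite -scalemxAl mulmxA; congr (_ - _ *: _ + _).
  (* The inverse of R_{s+1} in the momentum term cancels the leading factor of M_{s+1}, leaving
     b_s. *)
  by rewrite {1}/w [rprod Rm s.+1]/= -!mulmxA mulKmx ?Ru.
have wb s : vnorm (w s) = vnorm (b s) by rewrite /b (vnorm_isometry _ (X_st s)).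
have split_b s := vnorm_split kd U_orth (b s).
have cosE s := cos_theta kd U_orth k0 (X_st s).
(* The cosine is the least singular value of U_k^T X_s, so cosine times |w_s| is at most |U_k^T
   b_s|: the noise is relative to the signal. *)
have noise_top s : vnorm (F *m (Xi s *m w s)) <=
    32^-1 * (lam k.-1 - lam k) * vnorm (F *m b s).
  rewrite mulmxA; apply: le_trans (vnorm_le_opnorm _ _) _.
  apply: le_trans (ler_wpM2r (vnorm_ge0 _) (noiseF s)) _.
  rewrite cosE -[leLHS]mulrA ler_wpM2l ?mulr_ge0 ?subr_ge0 ?(ltW gap) //.
  by rewrite /b mulmxA; exact: sigma_min_le_vnorm.
have noise_bot s : vnorm (L *m (Xi s *m w s)) <= 32^-1 * (lam k.-1 - lam k) * eps *
    (vnorm (F *m b s) + vnorm (L *m b s)).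
  rewrite mulmxA; apply: le_trans (vnorm_le_opnorm _ _) _.
  apply: le_trans (ler_wpM2r (vnorm_ge0 _) (noiseL s)) _.
  case/andP: e01 => e0 e1.
  rewrite ler_wpM2l ?mulr_ge0 ?subr_ge0 ?(ltW gap) ?(ltW e0) // wb.
  rewrite -(@ler_pXn2r _ 2) ?nnegrE ?addr_ge0 ?vnorm_ge0 // split_b sqrrD.
  by rewrite lerD2r lerDl mulrn_wge0 // mulr_ge0 ?vnorm_ge0.
have topE (v : 'cV[R]_d) j : (F *m (A *m v)) j 0 = lam j * (F *m v) j 0.
  exact: (Ufirst_eigen kd A_sym A_eig).
have botE (v : 'cV[R]_d) j : (L *m (A *m v)) j 0 = lam (k + j)%N * (L *m v) j 0.
  exact: (Ulast_eigen A_sym A_eig).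
have addE m (u v : 'cV[R]_m) i : (u + v) i 0 = u i 0 + v i 0 by rewrite mxE.
have oppE m (u : 'cV[R]_m) i : (- u) i 0 = - u i 0 by rewrite mxE.
have scaleE m a (u : 'cV[R]_m) i : (a *: u) i 0 = a * u i 0 by rewrite mxE.
have top_eig (j : 'I_k) : lam k.-1 <= lam j.
  by apply: lam_mono; have := ltn_ord j; lia.
have bot_eig (j : 'I_(d - k)) : 0 <= lam (k + j)%N <= lam k.
  by have jd := ltn_ord j; rewrite lam_ge0 ?lam_mono //=; lia.
have lk0 : 0 < lam k.-1 by have [l0 _] := two_sqrt_discr b0 bl; lra.
rewrite -!mulmxA -/(w t) -/(b t).
apply: (@tangent_decay _ beta (lam k.-1) (lam k) x y eps _
  (fun s => vnorm (F *m b s)) (fun s => vnorm (L *m b s))) => //.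
- exact: tan_theta_ge0.
- by move=> s; exact: vnorm_ge0.
(* Moving the noise to the side of b_1 leaves a diagonal map with entries at least lambda_k / 2; the
   triangle inequality then gives the lower bound. *)
- have : lam k.-1 / 2 * vnorm (F *m b 0%N) <=
      vnorm (F *m b 1%N + - (F *m (Xi 0%N *m w 0%N))).
    have -> : F *m b 1%N + - (F *m (Xi 0%N *m w 0%N))
        = \col_j (lam j / 2 * (F *m b 0%N) j 0).
      rewrite b1 mulmxDr addrK -scalemxAr; apply/colP => j.
      by rewrite [RHS]mxE scaleE topE; field.
    by apply: vnorm_diag_ge => [|j]; [lra | have := top_eig j; lra].
  have := vnormD (F *m b 1%N) (- (F *m (Xi 0%N *m w 0%N))); rewrite vnormN.
  have := noise_top 0%N; lra.
- move=> s.
  have : lam k.-1 * vnorm (F *m b s.+1) <=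
      vnorm (F *m b s.+2 + (beta *: (F *m b s) + - (F *m (Xi s.+1 *m w s.+1)))).
    have -> : F *m b s.+2 + (beta *: (F *m b s) + - (F *m (Xi s.+1 *m w s.+1)))
        = \col_j (lam j * (F *m b s.+1) j 0).
      apply/colP => j.
      by rewrite [RHS]mxE bS !mulmxDr mulmxN -scalemxAr !(addE, oppE, scaleE) topE; ring.
    by apply: vnorm_diag_ge => [|j]; [exact: ltW | exact: top_eig].
  have := vnormD (F *m b s.+2) (beta *: (F *m b s) + - (F *m (Xi s.+1 *m w s.+1))).
  have := vnormD (beta *: (F *m b s)) (- (F *m (Xi s.+1 *m w s.+1))).
  rewrite vnormN vnormZ (gtr0_norm b0).
  have := noise_top s.+1; rewrite xE; lra.
- move=> s; apply: le_trans (_ : _ <= xplus beta (lam k) ^+ s * vnorm (L *m b 0%N) +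
    \sum_(i < s) chebU beta (lam k) (s - i.+1) * vnorm (L *m (Xi i *m w i))) _.
    apply: (@diag_forced_recurrence _ _ _ _ (fun j => lam (k + val j)%N)
      (fun s => L *m b s) (fun s => L *m (Xi s *m w s))) => // [j|r j].
      by rewrite b1 mulmxDr -scalemxAr !(addE, scaleE) botE; field.
    by rewrite bS !mulmxDr mulmxN -scalemxAr !(addE, oppE, scaleE) botE.
  rewrite lerD2l; apply: ler_sum => i _; apply: ler_wpM2l => //.
  by have [/ltW] := chebU_ratio (s - i.+1) b0 bl.
- by rewrite /b /w /= mul1mx !mulmxA; apply: vnorm_le_tan; rewrite // -cosE.
Qed.

(* lam i (0-based) is the paper's lambda_{i+1}; column i of U is u_{i+1}.
   So lambda_k = lam k.-1 and lambda_{k+1} = lam k. *)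
Theorem theorem12 :
  exists C : nat, forall (R : realType) (d k : nat)
    (A U : 'M[R]_d) (lam : nat -> R) (eps beta : R)
    (X : nat -> 'M[R]_(d, k)) (Rm : nat -> 'M[R]_k) (Xi : nat -> 'M[R]_(d, k)),
    (k < d)%N -> (1 <= k)%N ->
    0 < eps < 1 ->
    (* A symmetric positive semidefinite *)
    A^T = A ->
    (forall x : 'cV[R]_d, 0 <= (x^T *m A *m x) 0 0) ->
    (* eigen-decomposition: ordered nonnegative eigenvalues, orthonormal eigenvectors *)
    (forall i j : nat, (i <= j < d)%N -> lam j <= lam i) ->
    (forall i : nat, (i < d)%N -> 0 <= lam i) ->
    U^T *m U = 1%:M ->
    (forall i : 'I_d, A *m col i U = lam i *: col i U) ->
    lam k.-1 > lam k ->
    (* initial point *)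
    stiefel (X 0%N) ->
    cos (theta (Ufirst k U) (X 0%N)) > 0 ->
    (* momentum *)
    0 < beta -> lam k > 2 * Num.sqrt beta ->
    (* ANPM iterates (R_t invertible, so that R_t^{-1} is defined) *)
    isQR ((2%:R)^-1 *: (A *m X 0%N) + Xi 0%N) (X 1%N) (Rm 1%N) ->
    (forall t : nat, (1 <= t)%N -> Rm t \in unitmx) ->
    (forall t : nat, (1 <= t)%N ->
       isQR (A *m X t - beta *: (X t.-1 *m invmx (Rm t)) + Xi t)
            (X t.+1) (Rm t.+1)) ->
    (* perturbation bounds with c = 1/32 *)
    (forall t : nat,
       opnorm ((Ulast k U)^T *m Xi t) <= 32%:R^-1 * (lam k.-1 - lam k) * eps) ->
    (forall t : nat,
       opnorm ((Ufirst k U)^T *m Xi t)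
         <= 32%:R^-1 * (lam k.-1 - lam k) * cos (theta (Ufirst k U) (X t))) ->
    exists T : nat,
      T%:R <= C%:R * (xplus beta (lam k.-1) / (xplus beta (lam k.-1) - xplus beta (lam k)))
                   * (1 + Num.max 0 (ln (tan (theta (Ufirst k U) (X 0%N)) / eps)))
      /\ forall t : nat, (T <= t)%N -> sin (theta (Ufirst k U) (X t)) <= eps.
Proof.
(* 15 = 3 * 5: the factor 3 comes from [geometric_iteration_count] and 5 from [xplus_gap]. *)
exists 15%N => R d k A U lam eps beta X Rm Xi kd k0 e01 A_sym _ lam_mono lam_ge0 U_orth
  A_eig gap X0 cos0 b0 bl QR1 Ru QRS noiseL noiseF.
have X_st t : stiefel (X t).
  by case: t => [//|[|t]]; [case: QR1 | case: (QRS t.+1 isT)].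
have {}bl := ltW bl.
set lk := lam k.-1 in gap noiseL noiseF *; set l := lam k in gap bl noiseL noiseF *.
have [x xE] : {x | x = lk - 32^-1 * (lk - l)} by eexists.
have [y yE] : {y | y = (x + l) / 2} by eexists.
have decay : forall t z, vnorm ((Ulast k U)^T *m X t *m z) <=
    (5 / 2 * (xplus beta y / xplus beta x) ^+ t * tan (theta (Ufirst k U) (X 0%N))
     + eps / 14) * vnorm ((Ufirst k U)^T *m X t *m z).
  apply: (@anpm_decay _ _ _ A U lam eps beta x y X Rm Xi) => //.
    by case: QR1 => _ <-.
  by move=> t t1; case: (QRS t t1) => _ <-.
have [l0 _] := two_sqrt_discr b0 bl.
have h0 := tan_theta_ge0 kd U_orth k0 X0.
have xp_gap := xplus_gap b0 bl gap xE yE.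
have lk_gap : 0 < xplus beta lk - xplus beta l.
  rewrite subr_gt0 ltr_pM2r ?invr_gt0 //.
  by apply: ltr_leD => //; apply: ler_wsqrtr; nra.
have mu_lk : xplus beta x <= xplus beta lk by apply: xplus_le; lra.
have mu0 : 0 < xplus beta x by apply: xplus_gt0; lra.
have nu0 : 0 < xplus beta y by apply: xplus_gt0; lra.
(* The strict gap at lambda_k, through [xplus_gap], forces y^+ < x^+. *)
have r01 : 0 < xplus beta y / xplus beta x < 1.
  by rewrite divr_gt0 //= ltr_pdivrMr // mul1r; lra.
have [T [Tle TP]] := geometric_iteration_count r01 e01 h0.
exists T; split.
  apply: le_trans Tle _; apply: ler_wpM2r.
    by rewrite addr_ge0 // le_max lexx.
  have -> : 1 - xplus beta y / xplus beta x =
      (xplus beta x - xplus beta y) / xplus beta x by field; rewrite lt0r_neq0.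
  rewrite invf_div -[15%:R]/(15 : R).
  have : xplus beta x / (xplus beta x - xplus beta y) <=
      5 * (xplus beta lk / (xplus beta lk - xplus beta l)); last by lra.
  rewrite mulrA ler_pdivlMr // mulrAC ler_pdivrMr; last by lra.
  have : xplus beta x * (xplus beta lk - xplus beta l) <=
    xplus beta x * (5 * (xplus beta x - xplus beta y)) by rewrite ler_wpM2l // ltW.
  have : xplus beta x * (5 * (xplus beta x - xplus beta y)) <=
    xplus beta lk * (5 * (xplus beta x - xplus beta y)) by rewrite ler_wpM2r //; lra.
  lra.
move=> t Tt; case/andP: e01 => e0 e1.
apply: (sin_theta_le kd U_orth k0 (X_st t)); first by rewrite !ltW.
move=> z; apply: le_trans (decay t z) _; apply: ler_wpM2r; first exact: vnorm_ge0.
exact: TP.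
Qed.
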